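(* Let $S$ be a finite subset of $\mathbb{R}^n$ and let $f:S\to\mathbb{R}$ be a function. Then there exists a convex function $F\in C^1(\mathbb{R}^n)$ with $F=f$ on $S$ if and only if there exists a mapping $G:S\to\mathbb{R}^n$ such that both of the following hold: (a) $f(x)-f(y)\geq\langle G(y),x-y\rangle$ for all $x,y\in S$; (b) for all $x,y\in S$: if $f(x)-f(y)=\langle G(y),x-y\rangle$, then $G(x)=G(y)$. *)

(* Defs.v *)
From HB Require Import structures.
From mathcomp Require Import all_boot all_order all_algebra finmap.
From mathcomp Require Import all_classical all_reals all_analysis.

Set Implicit Arguments.
Unset Strict Implicit.
Unset Printing Implicit Defensive.

Import Order.TTheory GRing.Theory Num.Theory.
Import numFieldNormedType.Exports.

Local Open Scope classical_set_scope.
Local Open Scope ring_scope.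

Definition dotv (R : realType) (n : nat) (u v : 'rV[R]_n) : R :=
  \sum_(i < n) u 0 i * v 0 i.

Definition gradient (R : realType) (n : nat) (F : 'rV[R]_n -> R)
    (x : 'rV[R]_n) : 'rV[R]_n :=
  \row_(i < n) 'D_(delta_mx 0 i) F x.

(* [differentiable] is Frechet differentiability; the library's norm on
   ['rV[R]_n] is the sup norm, which gives the usual topology and the usual
   notion of differentiability of R^n. *)
Definition C1 (R : realType) (n : nat) (F : 'rV[R]_n -> R) : Prop :=
  (forall x, differentiable F x) /\ continuous (gradient F).

(* Main.v *)
(* Necessity: take [G] to be the gradient of [F]; (b) holds because [F] minus its
   tangent at [y] is nonnegative and vanishes at [x], so [x] minimizes it.
   Sufficiency: the tangent pieces [z |-> f y + <G y, z - y>] lie below [f] on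
   [S] by (a), and by (b) any piece that meets [f] at [x] is the piece of [x]
   itself. Finiteness of [S] gives a uniform gap [d > 0] between the piece of [x]
   and the distinct other pieces at [x]. Folding the distinct pieces with the
   smooth maximum [v + softpos e (u - v)], which equals [max u v] as soon as
   [e <= |u - v|], thus preserves the value [f x] at [x] when [e = d / 2]. *)
Require Import Defs.
From HB Require Import structures.
From mathcomp Require Import all_boot all_order all_algebra finmap.
From mathcomp Require Import all_classical all_reals all_analysis.
From mathcomp Require Import ring lra.

Set Implicit Arguments.
Unset Strict Implicit.
Unset Printing Implicit Defensive.

Import Order.TTheory GRing.Theory Num.Theory.
Import numFieldNormedType.Exports.

Local Open Scope fset_scope.
Local Open Scope classical_set_scope.
Local Open Scope ring_scope.

(** * Linear functionals and their derivatives *)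

Section dotv.
Variables (R : realType) (n : nat).
Implicit Types u v w : 'rV[R]_n.

Lemma dotvDr u v w : dotv u (v + w) = dotv u v + dotv u w.
Proof.
by rewrite /dotv -big_split; apply: eq_bigr => i _; rewrite mxE mulrDr.
Qed.

Lemma dotvZr u a v : dotv u (a *: v) = a * dotv u v.
Proof.
by rewrite /dotv mulr_sumr; apply: eq_bigr => i _; rewrite mxE; ring.
Qed.

Lemma dotvNr u v : dotv u (- v) = - dotv u v.
Proof. by rewrite -scaleN1r dotvZr mulN1r. Qed.

Lemma dotvBr u v w : dotv u (v - w) = dotv u v - dotv u w.
Proof. by rewrite dotvDr dotvNr. Qed.

Lemma dotv_delta u i : dotv u (delta_mx 0 i) = u 0 i.
Proof.
rewrite /dotv (bigD1 i)//= mxE !eqxx mulr1 big1 ?addr0// => j ji.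
by rewrite mxE (negbTE ji) andbF mulr0.
Qed.

Lemma differentiable_dotv u x : differentiable (dotv u) x.
Proof.
have -> : dotv u = \sum_(i < n) (u 0 i *: (fun v : 'rV[R]_n => v 0 i : R^o)).
  by apply/funext => v; rewrite fct_sumE.
by apply: differentiable_sum => i; apply: differentiableZ;
  exact: differentiable_coord.
Qed.

Lemma derive_dotv u x v : 'D_v (dotv u) x = dotv u v.
Proof.
apply/cvg_lim => //; apply: cvg_near_cst.
near=> h => /=; rewrite dotvDr dotvZr addrK /GRing.scale /= mulKf//.
near: h; exact: nbhs_dnbhs_neq.
Unshelve. all: by end_near. Qed.

End dotv.

(** * Directional derivatives, C^1 functions and tangents of convex functions *)

Section derivatives.
Variables (R : realType) (n : nat).
Implicit Types (F : 'rV[R]_n -> R) (x v : 'rV[R]_n).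

Lemma derive_gradient F x v :
  differentiable F x -> 'D_v F x = dotv (gradient F x) v.
Proof.
move=> dF; rewrite deriveE// [in LHS](row_sum_delta v) linear_sum /dotv.
by apply: eq_bigr => i _; rewrite linearZ /= mxE deriveE// mulrC.
Qed.

(** The differential is linear, so the coordinates of the gradient determine every directional
    derivative. Real-valued derivatives are easier to combine than row vectors. *)
Lemma C1P F : C1 F <->
  (forall x, differentiable F x) /\ (forall v, continuous ('D_v F)).
Proof.
split=> -[dF cF]; split=> //.
  move=> v; rewrite (_ : 'D_v F =
      fun y => \sum_(i < n) gradient F y 0 i * v 0 i).
    apply: continuous_big => [|i _ x]; first exact: add_continuous.
    apply: continuousM; last exact: cst_continuous.
    exact: (continuous_comp (cF x) (@coord_continuous _ _ _ 0 i _)).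
  by apply/funext => y; rewrite derive_gradient.
rewrite (_ : gradient F =
    fun x => \sum_(i < n) 'D_(delta_mx 0 i) F x *: delta_mx 0 i).
  apply: continuous_big => [|i _ x]; first exact: add_continuous.
  exact: (@continuousZr_tmp R 'rV[R]_n 'rV[R]_n _ (delta_mx 0 i) x (cF _ x)).
apply/funext => x; rewrite [LHS]row_sum_delta; apply: eq_bigr => i _.
by rewrite mxE.
Qed.

Lemma C1D F H : C1 F -> C1 H -> C1 (F \+ H).
Proof.
move=> /C1P[dF cF] /C1P[dH cH]; apply/C1P; split=> [x|v].
  exact: differentiableD.
rewrite (_ : 'D_v _ = 'D_v F \+ 'D_v H).
  by move=> x; apply: continuousD; [exact: cF|exact: cH].
by apply/funext => x; rewrite deriveD//; exact: diff_derivable.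
Qed.

Lemma C1N F : C1 F -> C1 (fun x => - F x).
Proof.
move=> /C1P[dF cF]; apply/C1P; split=> [x|v]; first exact: differentiableN.
rewrite (_ : 'D_v _ = \- 'D_v F).
  by move=> x; apply: continuousN; exact: cF.
by apply/funext => x; rewrite deriveN//; exact: diff_derivable.
Qed.

Lemma C1_cst a : C1 (fun _ : 'rV[R]_n => a).
Proof.
apply/C1P; split=> [x|v]; first exact: differentiable_cst.
rewrite (_ : 'D_v _ = cst 0); first exact: cst_continuous.
by apply/funext => x; rewrite derive_cst.
Qed.

Lemma C1_dotv (u : 'rV[R]_n) : C1 (dotv u).
Proof.
apply/C1P; split=> [x|v]; first exact: differentiable_dotv.
rewrite (_ : 'D_v _ = cst (dotv u v)); first exact: cst_continuous.
by apply/funext => x; rewrite derive_dotv.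
Qed.

Lemma C1_comp (g g' : R -> R) F :
    (forall t, is_derive t (1 : R) g (g' t)) -> continuous g' -> C1 F ->
  C1 (g \o F).
Proof.
move=> dg cg' /C1P[dF cF].
have dg' t : differentiable g t by apply/derivable1_diffP; exact: ex_derive.
apply/C1P; split=> [x|v]; first exact: differentiable_comp.
rewrite (_ : 'D_v _ = (g' \o F) \* 'D_v F).
  move=> x; apply: continuousM; last exact: cF.
  by apply: continuous_comp; [exact: differentiable_continuous|exact: cg'].
apply/funext => x; rewrite deriveE; last exact: differentiable_comp.
rewrite diff_comp//= (diff1E (dg' (F x))) derive1E derive_val -deriveE//.
exact: mulrC.
Qed.

(** For a differentiable function the right-hand limit of the quotients is the derivative, so
    positive [t] suffice; [t <= 1] is what convexity on a segment provides. *)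
Lemma derive_le F x v c : differentiable F x ->
  (forall t, 0 < t <= 1 -> F (x + t *: v) - F x <= t * c) -> 'D_v F x <= c.
Proof.
move=> dF Fc.
have Dx : derivable F x v by exact: diff_derivable.
rewrite ['D_v F x]cvg_at_rightE; last exact: Dx.
apply: limr_le.
  rewrite -(cvg_at_rightE
    (fun h : R => h^-1 *: ((F \o shift x) (h *: v) - F x)))//.
  apply: cvg_trans Dx; apply: cvg_app => A [e e0 Ae]; exists e => // t te t0.
  by apply: Ae => //; exact/lt0r_neq0.
near=> h; have h0 : 0 < h by near: h; exact: nbhs_right_gt.
rewrite /GRing.scale/= ler_pdivrMl// (addrC (h *: v)) Fc// h0/=.
by near: h; exact: nbhs_right_le ltr01.
Unshelve. all: by end_near. Qed.

Lemma convex_functionP F : convex_function [set: 'rV[R]_n] F <->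
  forall a x y, 0 <= a <= 1 ->
    F (a *: x + (1 - a) *: y) <= a * F x + (1 - a) * F y.
Proof.
split=> [cF a x y a01|cF t x y _ _]; last by apply: cF; rewrite ge0 le1.
have [a0 a1] := andP a01.
exact: (cF (Itv01 a0 a1) x y (in_setT _) (in_setT _)).
Qed.

(** On the segment from [y] to [x], convexity bounds the increment of [F] by [t * (F x - F y)]. *)
Lemma convex_gradient_le F x y : convex_function [set: 'rV[R]_n] F ->
  differentiable F y -> dotv (gradient F y) (x - y) <= F x - F y.
Proof.
move=> /convex_functionP cF dF; rewrite -derive_gradient//.
apply: derive_le => // t /andP[t0 t1].
have := cF t x y; rewrite (ltW t0) t1 => /(_ isT).
have -> : t *: x + (1 - t) *: y = y + t *: (x - y).
  by rewrite scalerBl scale1r scalerBr addrCA.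
lra.
Qed.

(* The gap between [F] and its tangent at [y] attains its minimum [0] at [x]. *)
Lemma convex_gradient_eq F x y : convex_function [set: 'rV[R]_n] F ->
    differentiable F x -> differentiable F y ->
  F x - F y = dotv (gradient F y) (x - y) -> gradient F x = gradient F y.
Proof.
move=> cF dFx dFy Fxy.
have ge v : dotv (gradient F y) v <= dotv (gradient F x) v.
  rewrite -(derive_gradient v dFx) -lerN2 -deriveN; last exact: diff_derivable.
  apply: derive_le; first exact: differentiableN.
  move=> t _; have := convex_gradient_le (x + t *: v) cF dFy.
  by rewrite (addrAC x) dotvDr dotvZr -Fxy -![(- F) _]/(- F _); lra.
apply/rowP => i; apply/eqP; rewrite eq_le -!dotv_delta ge.
by have := ge (- delta_mx 0 i); rewrite !dotvNr lerN2 => ->.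
Qed.

End derivatives.

(** * A smooth convex positive part *)

Section softpos.
Variable R : realType.
Implicit Types c d e s t u : R.

Definition clamp u : R := Num.max 0 (Num.min 1 u).

Lemma clamp01 u : 0 <= clamp u <= 1.
Proof.
by rewrite /clamp le_max lexx/= ge_max ler01 ge_min lexx.
Qed.

Lemma clamp_nearest u c : 0 <= c <= 1 -> (clamp u - u) ^+ 2 <= (c - u) ^+ 2.
Proof.
move=> /andP[c0 c1]; rewrite /clamp; case: (leP 1 u) => u1.
  by rewrite max_r ?ler01//; nra.
case: (leP 0 u) => u0; first by rewrite subrr expr0n sqr_ge0.
by rewrite ler_sqr ?nnegrE; lra.
Qed.

Lemma continuous_clamp : continuous clamp.
Proof.
move=> u; apply: (@continuous_max R R (cst 0)); first exact: cvg_cst.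
by apply: (@continuous_min R R (cst 1)); [exact: cvg_cst|exact: cvg_id].
Qed.

(* Equal to [max_(0 <= s <= 1) (s * (t + e) - e * s ^+ 2)]: a convex C^1
   version of [max 0 t], exact for [e <= `|t|]; the maximizer is its
   derivative. *)
Definition softpos' e t := clamp ((t + e) / (2 * e)).
Definition softpos e t := softpos' e t * (t + e) - e * softpos' e t ^+ 2.

Lemma softpos'01 e t : 0 <= softpos' e t <= 1. Proof. exact: clamp01. Qed.

Lemma continuous_softpos' e : continuous (softpos' e).
Proof.
move=> t; apply: (@continuous_comp _ _ _ (fun t => (t + e) / (2 * e)) clamp);
  last exact: continuous_clamp.
apply: continuousM; last exact: cst_continuous.
by apply: continuousD; [exact: cvg_id|exact: cst_continuous].
Qed.

Variables (e : R) (e0 : 0 < e).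

(** With [t + e = 2 * e * u], the left side is [e * (u ^+ 2 - (c - u) ^+ 2)], which is largest at
    the [c] in [0, 1] nearest to [u], namely [clamp u]. *)
Lemma softpos_ge t c : 0 <= c <= 1 -> c * (t + e) - e * c ^+ 2 <= softpos e t.
Proof.
move=> c01; rewrite /softpos /softpos'; set u := (t + e) / (2 * e).
have -> : t + e = 2 * e * u by rewrite /u; field; rewrite gt_eqF.
have := clamp_nearest u c01; move: (clamp u) => s; rewrite -(ler_pM2l e0); lra.
Qed.

Lemma softpos_id t : e <= t -> softpos e t = t.
Proof.
move=> et; rewrite /softpos (_ : softpos' e t = 1); first by lra.
rewrite /softpos' /clamp min_l ?max_r//.
by rewrite ler_pdivlMr ?mulr_gt0//; lra.
Qed.

Lemma softpos_eq0 t : t <= - e -> softpos e t = 0.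
Proof.
move=> et; rewrite /softpos (_ : softpos' e t = 0); first by lra.
rewrite /softpos' /clamp max_l// ge_min; apply/orP; right.
by rewrite ler_pdivrMr ?mulr_gt0//; lra.
Qed.

(** The maximizer at [t + d] is a slope at most 1. Hence [v + softpos e (u - v)] is nondecreasing in
    [v]. *)
Lemma softpos_leD t d : 0 <= d -> softpos e (t + d) <= softpos e t + d.
Proof.
move=> d0; have s01 := softpos'01 e (t + d).
have := softpos_ge t s01; rewrite [softpos e (t + d)]/softpos.
move: (softpos' _ _) s01 => s /andP[s0 s1]; nra.
Qed.

Lemma softpos_le t c : 0 <= c -> t + e <= c -> softpos e t <= c.
Proof.
move=> c0 tc; have := softpos'01 e t; rewrite /softpos.
move: (softpos' _ _) => s /andP[s0 s1].
have : 0 <= e * s ^+ 2 by rewrite mulr_ge0 ?sqr_ge0// ltW.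
nra.
Qed.

(** A maximum of affine functions of [t]: the maximizer at the combination is tested at both
    ends. *)
Lemma softpos_convex a t s : 0 <= a <= 1 ->
  softpos e (a * t + (1 - a) * s) <= a * softpos e t + (1 - a) * softpos e s.
Proof.
move=> /andP[a0 a1]; rewrite {1}/softpos; set z := a * t + _.
have z01 := softpos'01 e z; move: (softpos' e z) z01 => c c01.
have := softpos_ge t c01; have := softpos_ge s c01.
have b0 : 0 <= 1 - a by lra.
move=> /(ler_wpM2l b0) + /(ler_wpM2l a0).
rewrite /z; lra.
Qed.

(** Envelope argument: testing the maximizer of each of [t] and [t + h] at the other point squeezes
    the difference quotient between the two maximizers, which merge as [h] tends to 0. *)
Lemma is_derive_softpos t : is_derive t 1 (softpos e) (softpos' e t).
Proof.
suff D : h^-1 *: ((softpos e \o shift t) (h *: (1 : R)) - softpos e t)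
    @[h --> 0^'] --> softpos' e t.
  by apply: DeriveDef; [exact: cvgP D|exact: cvg_lim D].
have /continuous_withinNx : {for 0, continuous (fun h => softpos' e (t + h))}.
  apply: (@continuous_comp _ _ _ (fun h => t + h) (softpos' e));
    last exact: continuous_softpos'.
  by apply: cvgD; [exact: cst_continuous|exact: cvg_id].
rewrite addr0 => /cvgrPdist_le cs.
apply/cvgrPdist_le => d d0; near=> h.
have h0 : h != 0 by near: h; exact: nbhs_dnbhs_neq.
have : `|softpos' e t - softpos' e (t + h)| <= d by near: h; exact: cs.
rewrite /= /GRing.scale/= mulr1 (addrC h t).
have := softpos_ge t (softpos'01 e (t + h)).
have := softpos_ge (t + h) (softpos'01 e t).
(* Naming the quotient [q] removes the inverse of [h], leaving polynomial inequalities. *)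
have [q qE] : exists q, softpos e (t + h) - softpos e t = h * q.
  by exists (h^-1 * (softpos e (t + h) - softpos e t)); rewrite mulVKf.
rewrite qE mulKf//.
have := erefl (softpos e (t + h)); rewrite {1}/softpos.
have := erefl (softpos e t); rewrite {1}/softpos.
move: qE; move: (softpos e t) (softpos e (t + h)).
move: (softpos' e t) (softpos' e (t + h)) => s0 s1 f0 f1 qE f0E f1E lo hi.
have {}lo : s0 * h <= h * q by lra.
have {}hi : h * q <= s1 * h by lra.
rewrite !ler_norml => /andP[sd1 sd2]; apply/andP.
by case: (ltgtP h 0) h0 => // h0 _; split; nra.
Unshelve. all: by end_near. Qed.

End softpos.

(** * Smooth maximum of finitely many affine pieces *)

Section softmax.
Variables (R : realType) (n : nat) (e c0 : R).
Hypothesis e0 : 0 < e.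
Implicit Types (p q : 'rV[R]_n * R) (l : seq ('rV[R]_n * R)) (x : 'rV[R]_n).

Definition affine p x := dotv p.1 x + p.2.

Lemma affine_conv p a x y :
  affine p (a *: x + (1 - a) *: y) = a * affine p x + (1 - a) * affine p y.
Proof. by rewrite /affine dotvDr !dotvZr; ring. Qed.

Fixpoint softmax l x : R :=
  if l is p :: l' then softmax l' x + softpos e (affine p x - softmax l' x)
  else c0.

Lemma C1_softmax l : C1 (softmax l).
Proof.
elim: l => [|p l IH]; first exact: C1_cst.
have Cp : C1 (affine p) by apply: C1D; [exact: C1_dotv|exact: C1_cst].
apply: C1D => //; apply: (@C1_comp _ _ (softpos e) (softpos' e)).
- exact: is_derive_softpos.
- exact: continuous_softpos'.
- exact: C1D (C1N IH).
Qed.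

Lemma softmax_convex l : convex_function [set: 'rV[R]_n] (softmax l).
Proof.
apply/convex_functionP; elim: l => [|p l IH] a x y a01 /=; first by lra.
rewrite affine_conv; have := IH a x y a01; have := @softpos_convex _ _ e0 a
  (affine p x - softmax l x) (affine p y - softmax l y) a01.
set v := softmax l (_ + _); set w := a * softmax l x + _ => cvx vw.
(* Monotonicity in the accumulated value replaces [v] by the larger [w]; convexity of [softpos] then
   finishes. *)
have := @softpos_leD _ _ e0 (a * affine p x + (1 - a) * affine p y - w) (w - v).
rewrite addrA subrK subr_ge0 => /(_ vw).
rewrite (_ : _ - w = a * (affine p x - softmax l x) +
  (1 - a) * (affine p y - softmax l y)); last by rewrite /w; ring.
rewrite /w in vw *; lra.
Qed.

(** The slack [e] does not accumulate along the fold: each step keeps the value below [c] by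
    [softpos_le] with bound [c - softmax l x]. *)
Lemma softmax_le l x c : c0 <= c -> {in l, forall p, affine p x + e <= c} ->
  softmax l x <= c.
Proof.
move=> c0c; elim: l => //= p l IH lc.
have {}IH : softmax l x <= c.
  by apply: IH => q ql; apply: lc; rewrite inE ql orbT.
rewrite -lerBrDl softpos_le// ?subr_ge0//.
by have := lc p (mem_head _ _); lra.
Qed.

(** Of the gap [2 * e], one [e] is the slack of [softmax_le] for the pieces folded before [p], the
    other makes [p] take over exactly. Pieces folded after [p] then add 0. *)
Lemma softmax_eq l p x : uniq l -> p \in l -> c0 <= affine p x - e ->
    {in l, forall q, q != p -> affine q x + 2 * e <= affine p x} ->
  softmax l x = affine p x.
Proof.
elim: l => //= q l IH /andP[ql ul]; rewrite inE => /predU1P[->|pl] c0p lp.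
  have : softmax l x <= affine q x - e.
    apply: softmax_le => // r rl.
    have rq : r != q by apply: contraNneq ql => <-.
    by have := lp r; rewrite inE rl orbT => /(_ isT rq); lra.
  by move=> le_q; rewrite (softpos_id e0) ?subrKC // lerBrDl -lerBrDr.
rewrite IH// => [|r rl]; last by apply: lp; rewrite inE rl orbT.
have qp : q != p by apply: contraNneq ql => ->.
have := lp q (mem_head _ _) qp => le_p; rewrite softpos_eq0 ?addr0//.
by have := e0; lra.
Qed.

End softmax.

(** * Uniform gap and proof of the equivalence *)

Lemma fin_lower_bound (R : realDomainType) (T : finType) (P : pred T)
    (g : T -> R) : (forall t, P t -> 0 < g t) ->
  exists2 e, 0 < e & forall t, P t -> e <= g t.
Proof.
(* The default 1 keeps the minimum positive when no index satisfies [P]. *)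
move=> g0; exists (\big[Num.min/1]_(t | P t) g t).
  by apply/bigmin_gtP; split.
by move=> t Pt; exact: bigmin_le_cond.
Qed.

Theorem corollary1p11 (R : realType) (n : nat) (S : {fset 'rV[R]_n})
    (f : S -> R) :
  (exists F : 'rV[R]_n -> R,
      [/\ convex_function [set: 'rV[R]_n] F, C1 F
        & forall x : S, F (val x) = f x])
  <->
  (exists G : S -> 'rV[R]_n,
      (forall x y : S, dotv (G y) (val x - val y) <= f x - f y) /\
      (forall x y : S, f x - f y = dotv (G y) (val x - val y) -> G x = G y)).
Proof.
split=> [[F [cF [dF _] Ff]]|[G [Gle Geq]]].
  exists (fun x => gradient F (val x)); split=> x y; rewrite -!Ff.
    exact: convex_gradient_le.
  exact: convex_gradient_eq.
pose p y := (G y, f y - dotv (G y) (val y)).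
have pE x y : affine (p y) (val x) = f y + dotv (G y) (val x - val y).
  by rewrite /affine dotvBr/=; ring.
have pxx x : affine (p x) (val x) = f x.
  by rewrite pE dotvBr subrr addr0.
(* Pieces are compared, not points, since distinct points may share a piece. A nonpositive gap is
   equality by (a); then (b) equates the slopes, hence the intercepts. *)
have gap xy : p xy.2 != p xy.1 -> 0 < f xy.1 - affine (p xy.2) (val xy.1).
  case: xy => x y /=; apply: contraNT; rewrite -leNgt pE => le0.
  have fE : f x - f y = dotv (G y) (val x - val y).
    by apply/eqP; rewrite eq_le Gle andbT; lra.
  rewrite /p (Geq _ _ fE); apply/eqP; congr pair.
  by move: fE; rewrite dotvBr; lra.
have [d d0 dP] := fin_lower_bound gap.
pose e := d / 2; have e0 : 0 < e by rewrite divr_gt0.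
(* The seed lies at least [e] below every value of [f], so it leaves the values on [S] unchanged. *)
pose c0 := \big[Num.min/0]_x (f x - e).
pose l := undup (codom p).
exists (softmax e c0 l); split; [exact: softmax_convex|exact: C1_softmax|].
move=> x; rewrite -[RHS]pxx; apply: softmax_eq => //.
- exact: undup_uniq.
- by rewrite mem_undup codom_f.
- by rewrite pxx /c0 bigmin_le.
- move=> q; rewrite mem_undup => /codomP[y ->] yx.
  by have := dP (x, y) yx; rewrite pxx /= /e; lra.
Qed.
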